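(* For any finite set $S$ of at least three points in the plane $\mathbb{R}^2$, there exists a Tverberg cycle for $S$; that is, there exists a Hamiltonian cycle $G$ with vertex set $S$ such that $$\bigcap_{xy\in E(G)} B(xy)\neq\emptyset .$$
   Context: For two points $x,y\in\mathbb{R}^d$, $B(xy)$ denotes the closed Euclidean ball for which the segment $xy$ is a diameter, i.e. the closed ball with center $\frac{x+y}{2}$ and radius $\frac{\|x-y\|}{2}$. A graph $G$ whose vertex set is a finite set of points in $\mathbb{R}^d$ is called a Tverberg graph if $\bigcap_{xy\in E(G)}B(xy)\neq\emptyset$. A Hamiltonian cycle for a finite set of points (a cycle whose vertex set is the whole set) is called a Tverberg cycle if it is a Tverberg graph. *)

(* Defs.v *)
From HB Require Import structures.
From mathcomp Require Import all_boot all_order all_algebra.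
From mathcomp Require Import finmap.
From mathcomp Require Import boolp classical_sets reals.

Set Implicit Arguments.
Unset Strict Implicit.
Unset Printing Implicit Defensive.

Import Order.TTheory GRing.Theory Num.Theory.
Local Open Scope classical_set_scope.
Local Open Scope ring_scope.

(* The norm that the analysis library puts on matrices is the sup norm, hence
   a separate Euclidean norm. *)
Definition enorm (R : realType) (d : nat) (x : 'rV[R]_d) : R :=
  Num.sqrt (\sum_(i < d) x ord0 i ^+ 2).

(* The closed ball B(xy) having the segment xy as a diameter. *)
Definition diam_ball (R : realType) (d : nat) (x y : 'rV[R]_d) :
    set 'rV[R]_d :=
  [set z | enorm (z - 2^-1 *: (x + y)) <= enorm (x - y) / 2].

(* Finite simple graphs whose vertices are points of R^d. *)
Record geom_graph (R : realType) (d : nat) := GeomGraph {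
  vertices : {fset 'rV[R]_d};
  adj : rel 'rV[R]_d;
  adj_vertices : forall x y, adj x y -> (x \in vertices) && (y \in vertices);
  adj_sym : symmetric adj;
  adj_irrefl : irreflexive adj
}.

(* Every edge occurs in both orientations; this is harmless for intersections
   of the balls B(xy), as B(xy) = B(yx). *)
Definition edges (R : realType) (d : nat) (G : geom_graph R d) :
    set ('rV[R]_d * 'rV[R]_d) :=
  [set e | adj G e.1 e.2].

Definition tverberg_graph (R : realType) (d : nat) (G : geom_graph R d) : Prop :=
  \bigcap_(e in edges G) diam_ball e.1 e.2 !=set0.

(* The vertices can be listed cyclically, without repetition, so that the edges
   are exactly the pairs of cyclically consecutive vertices. *)
Definition is_cycle (R : realType) (d : nat) (G : geom_graph R d) : Prop :=
  exists c : seq 'rV[R]_d,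
    [/\ uniq c,
        (3 <= size c)%N,
        c =i vertices G &
        {in vertices G &, forall x y,
          adj G x y = (y == next c x) || (x == next c y)}].

Definition hamiltonian_cycle (R : realType) (d : nat) (S : {fset 'rV[R]_d})
    (G : geom_graph R d) : Prop :=
  is_cycle G /\ vertices G = S.

Definition tverberg_cycle (R : realType) (d : nat) (S : {fset 'rV[R]_d})
    (G : geom_graph R d) : Prop :=
  hamiltonian_cycle S G /\ tverberg_graph G.

(* Main.v *)
Require Import Defs.
From mathcomp Require Import all_boot all_order all_algebra.
From mathcomp Require Import finmap.
From mathcomp Require Import reals.
From mathcomp Require Import zify ring lra.

Set Implicit Arguments.
Unset Strict Implicit.
Unset Printing Implicit Defensive.

Import Order.TTheory GRing.Theory Num.Theory.

(** A point [o] lies in B(xy) exactly when the vectors [x - o] and [y - o]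
    have non-positive inner product ([obtuse]), so one looks for a point
    [o] and a cyclic order of S in which all consecutive pairs are obtuse
    at [o].

    Fix two perpendicular lines through [o]. Two points in opposite closed
    quadrants are obtuse at [o], hence a pair of opposite quadrants with
    equally many points, or with one point more on one side, is traversed
    by a path zigzagging between them. If both lines halve S, opposite
    quadrants have nearly equal sizes, and there remains the task of
    joining the two zigzags. Points lying on one of the lines do this: a
    point on the upper half of the vertical line belongs to both upper
    quadrants, so it may be followed by any point below. A cycle needs two
    such connecting points.

    To get them, take for [x] the lexicographically first point of S, an
    extreme point of the convex hull, and for [y] a median of the other
    points in the angular order around [x]: the line xy, called vertical
    below, halves S and has two points of S on it ([halving_line]). The
    horizontal line is the perpendicular one through a median [q] of the
    projections to the line xy, and [o] is the intersection point.
    - If #|S| is even, [x] and [y] connect the two zigzags; see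
      [cycle_two_points_on_axis].
    - If #|S| is odd, the horizontal line halves S only after removal of
      [q]. One of [x], [y] that differs from [q] is removed likewise to
      make the vertical line halve the rest, the other one of [x], [y]
      being counted to the smaller side. The removed points, one on each
      line, connect the two zigzags; see [cycle_one_point_per_axis].

    Points in degenerate position are covered because ties in either order
    are broken by a sort: all that the argument uses of a point is that it
    lies in the closed half-planes that it has been assigned to. *)

(** * Cycles through four quadrants *)

Section Zigzag.
Variables (T : eqType) (r : rel T).
Hypothesis r_sym : symmetric r.

(** Meant for [size A = size B] and [size A = (size B).+1], when the
    entries alternate between [A] and [B]. *)
Fixpoint zigzag (A B : seq T) : seq T :=
  match A, B with
  | a :: A', b :: B' => a :: b :: zigzag A' B'
  | _, _ => A ++ B
  end.

Lemma perm_zigzag A B : perm_eq (zigzag A B) (A ++ B).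
Proof.
elim: A B => [|a A IH] [|b B] //=.
rewrite perm_cons perm_sym (perm_catCA A [:: b] B) /= perm_cons perm_sym.
exact: IH.
Qed.

(** The path ends in [A] or in [B] according to the parity [d], so only
    that side has to be related to [q]. *)
Lemma zigzag_path (d : bool) p q A B :
    size A = (d + size B)%N ->
    {in A & B, forall a b, r a b} ->
    {in A, forall a, r p a} ->
    {in if d then A else B, forall z, r z q} ->
    (A = [::] -> r p q) ->
  path r p (rcons (zigzag A B) q).
Proof.
elim: A B p => [|a A IH] [|b B] p /= sz rAB rp rq rpq.
- by rewrite rpq.
- by case: (d) sz.
- case: (d) sz rq => //= -[] /size0nil -> rq.
  by rewrite /= rp ?mem_head // rq ?mem_head.
- rewrite rp ?mem_head // rAB ?mem_head //=; apply: IH.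
  + by move: sz; rewrite addnS => -[].
  + by move=> u w uA wB; apply: rAB; rewrite inE ?uA ?wB orbT.
  + by move=> u uA; rewrite r_sym rAB // inE ?uA ?eqxx ?orbT.
  + by move=> u uX; apply: rq; case: (d) uX => uX; rewrite inE uX orbT.
  + move=> A0; move: sz rq; rewrite A0; case: (d) => /= [|_ rq]; first by lia.
    by rewrite rq ?mem_head.
Qed.

Lemma two_arcs_cycle p q A B C D s :
    perm_eq s ((A ++ B) ++ (C ++ D)) ->
    path r p (rcons (zigzag A B) q) -> path r q (rcons (zigzag C D) p) ->
  exists2 c, perm_eq c [:: p, q & s] & cycle r c.
Proof.
move=> ps pAB pCD; exists (p :: zigzag A B ++ q :: zigzag C D).
  rewrite perm_cons perm_catC /= perm_cons perm_catC perm_sym.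
  by rewrite (perm_trans ps) // perm_sym perm_cat // perm_zigzag.
by rewrite /= rcons_cat /= -cat_rcons cat_path pAB last_rcons.
Qed.

(** The labels [v] and [h] tell the side of the horizontal and of the
    vertical line, respectively, that a point is assigned to. *)
Definition quadrant (v h : pred T) (i j : bool) s :=
  [seq z <- s | (v z == i) && (h z == j)].

Lemma perm_quadrants v h i j s :
  perm_eq s ((quadrant v h i j s ++ quadrant v h (~~ i) (~~ j) s) ++
             (quadrant v h i (~~ j) s ++ quadrant v h (~~ i) j s)).
Proof.
apply/permP => P; rewrite !count_cat /quadrant !count_filter.
elim: s => //= z s ->.
by case: (v z); case: (h z); case: (P z); case: i; case: j => /=; lia.
Qed.

Lemma size_quadrants v h s :
  [/\ count v s = size (quadrant v h true true s) +
                  size (quadrant v h true false s),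
      count h s = size (quadrant v h true true s) +
                  size (quadrant v h false true s) &
      size s = (size (quadrant v h true true s) +
                size (quadrant v h true false s)) +
               (size (quadrant v h false true s) +
                size (quadrant v h false false s))]%N.
Proof.
rewrite /quadrant !size_filter.
by elim: s => //= z s [-> -> ->]; case: (v z); case: (h z) => /=; split; lia.
Qed.

Lemma opposite_quadrants v h i j s :
    {in s &, forall z w, v z != v w -> h z != h w -> r z w} ->
  {in quadrant v h i j s & quadrant v h (~~ i) (~~ j) s, forall z w, r z w}.
Proof.
move=> rs z w; rewrite !mem_filter => /andP[/andP[/eqP vz /eqP hz] zs].
move=> /andP[/andP[/eqP vw /eqP hw] ws].
by apply: rs; rewrite // ?vz ?vw ?hz ?hw; case: (i) (j) => [] [].
Qed.

(** Since [x] and [y] lie on the vertical line, they have to differ only in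
    the label [v] from a neighbour. Let [x] be up. If [y] is down, opposite
    quadrants have equal sizes; the first zigzag leaves the lower side
    after [x] and arrives at [y] from the upper side, and the second one
    returns in the same manner. If [y] is up, each lower quadrant has one
    point more than the opposite upper one, so that both zigzags start and
    end on the lower side. *)
Lemma cycle_two_points_on_axis (v h : pred T) x y s m :
    size s = m.*2 -> count h s = m -> count v [:: x, y & s] = m.+1 ->
    {in s &, forall z w, v z != v w -> h z != h w -> r z w} ->
    {in y :: s, forall w, v x != v w -> r x w} ->
    {in s, forall w, v y != v w -> r y w} ->
  exists2 c, perm_eq c [:: x, y & s] & cycle r c.
Proof.
move=> szs hs.
wlog vx : v / v x = true => [hwlog vs rs rx ry|].
  case vx: (v x); first exact: hwlog vs rs rx ry.
  apply: (hwlog (predC v)) => [||z w zs ws|w ws|w ws] /=; rewrite ?vx //.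
  - by have := count_predC v [:: x, y & s]; rewrite vs /= szs; lia.
  - by rewrite (inj_eq negb_inj); apply: rs.
  - by move=> vw; apply: rx => //; rewrite vx; case: (v w) vw.
  - by rewrite (inj_eq negb_inj); apply: ry.
rewrite /= vx => vs rs rx ry.
have [cv ch cs] := size_quadrants v h s.
have rxq j : {in quadrant v h false j s, forall z, r x z}.
  move=> z; rewrite mem_filter => /andP[/andP[/eqP vz _] zs].
  by apply: rx; rewrite ?vz // inE zs orbT.
have ryq i j : i != v y -> {in quadrant v h i j s, forall z, r y z}.
  move=> iy z; rewrite mem_filter => /andP[/andP[/eqP vz _] zs].
  by apply: ry; rewrite // vz eq_sym.
case vy: (v y) => /= in vs ryq.
- apply: (two_arcs_cycle (perm_quadrants v h false false s));
    apply: (@zigzag_path true) => /=; try exact: opposite_quadrants.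
  + lia.
  + exact: rxq.
  + by move=> z zq; rewrite r_sym (ryq false false).
  + by move/(congr1 size) => /=; lia.
  + lia.
  + exact: ryq.
  + by move=> z zq; rewrite r_sym (rxq true).
  + by move/(congr1 size) => /=; lia.
- have rxy : r x y by apply: rx; rewrite ?mem_head ?vy.
  have perm_s : perm_eq s
      ((quadrant v h false false s ++ quadrant v h true true s) ++
       (quadrant v h true false s ++ quadrant v h false true s)).
    rewrite (perm_trans (perm_quadrants v h false false s)) //.
    by rewrite perm_cat2l perm_catC.
  apply: (two_arcs_cycle perm_s); apply: (@zigzag_path false) => /=;
    try exact: opposite_quadrants.
  + lia.
  + exact: rxq.
  + by move=> z zq; rewrite r_sym (ryq true true).
  + by [].
  + lia.
  + exact: ryq.
  + by move=> z zq; rewrite r_sym (rxq true).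
  + by rewrite r_sym.
Qed.

(** Let [p], on the vertical line, be up, and let [q], on the horizontal
    one, have the label [h]. Counting shows that the quadrants up without
    [h] and down with [h] have the same size, while the quadrant opposite
    to [p] and [q] has one point more than its opposite. The first zigzag
    therefore goes from [p] to [q] through the equal quadrants, entering
    from below and leaving on the side opposite to [q]; the second one
    starts and ends in the larger quadrant, which is related to both [p]
    and [q]. If the equal quadrants are empty, [p] and [q] become adjacent,
    whence the last hypothesis. *)
Lemma cycle_one_point_per_axis (v h : pred T) p q s m :
    size s = m.*2.+1 -> count v (p :: s) = m.+1 -> count h (q :: s) = m.+1 ->
    {in s &, forall z w, v z != v w -> h z != h w -> r z w} ->
    {in s, forall w, v p != v w -> r p w} ->
    {in s, forall w, h q != h w -> r q w} ->
    r p q ->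
  exists2 c, perm_eq c [:: p, q & s] & cycle r c.
Proof.
move=> szs.
wlog vp : v / v p = true => [hwlog vs hs rs rp rq|].
  case vp: (v p); first exact: hwlog vs hs rs rp rq.
  apply: (hwlog (predC v)) => [|||z w zs ws|w ws|] //=; rewrite ?vp //.
  - by have := count_predC v (p :: s); rewrite vs /= vp szs; lia.
  - by rewrite (inj_eq negb_inj); apply: rs.
  - by move=> vw; apply: rp => //; rewrite vp; case: (v w) vw.
wlog hq : h / h q = true => [hwlog vs hs rs rp rq|].
  case hq: (h q); first exact: hwlog vs hs rs rp rq.
  apply: (hwlog (predC h)) => [|||z w zs ws||w ws] //=; rewrite ?hq //.
  - by have := count_predC h (q :: s); rewrite hs /= hq szs; lia.
  - by rewrite (inj_eq negb_inj); apply: rs.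
  - by move=> hw; apply: rq => //; rewrite hq; case: (h w) hw.
rewrite /= vp hq => vs hs rs rp rq rpq.
have [cv ch cs] := size_quadrants v h s.
have rpQ j : {in quadrant v h false j s, forall z, r p z}.
  move=> z; rewrite mem_filter => /andP[/andP[/eqP vz _] zs].
  by apply: rp; rewrite // vz.
have rqQ i : {in quadrant v h i false s, forall z, r q z}.
  move=> z; rewrite mem_filter => /andP[/andP[_ /eqP hz] zs].
  by apply: rq; rewrite // hz.
apply: (two_arcs_cycle (perm_quadrants v h false true s)).
- apply: (@zigzag_path false) => /=; try exact: opposite_quadrants.
  + lia.
  + exact: rpQ.
  + by move=> z zq; rewrite r_sym (rqQ true).
  + by [].
- apply: (@zigzag_path true) => /=; try exact: opposite_quadrants.
  + lia.
  + exact: rqQ.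
  + by move=> z zq; rewrite r_sym (rpQ false).
  + by move/(congr1 size) => /=; lia.
Qed.
End Zigzag.

(** * Splitting at a given rank *)

Lemma median_split (T : eqType) (le : rel T) (s : seq T) k :
    {in s & &, transitive le} -> {in s &, total le} -> (k < size s)%N ->
  exists L y U, [/\ perm_eq s (L ++ y :: U), size L = k,
    {in L, forall z, le z y} & {in U, forall z, le y z}].
Proof.
move=> le_trans le_total ks.
have [x0 _] : {x0 | x0 \in s}.
  by case: s ks {le_trans le_total} => // x s; exists x; rewrite mem_head.
pose t := sort le s.
have szt : size t = size s by rewrite size_sort.
have deft : t = take k t ++ nth x0 t k :: drop k.+1 t.
  by rewrite -drop_nth ?szt // cat_take_drop.
have in_s : all [in s] s by apply/allP.
have in_t : all [in s] t by apply/allP => z; rewrite mem_sort.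
have := sort_sorted_in le_total in_s.
rewrite -/t (sorted_pairwise_in (P := [in s])) // deft pairwise_cat /=.
rewrite allrel_consr.
move=> /and3P[/andP[/allP leL _] _ /andP[/allP leU _]].
exists (take k t), (nth x0 t k), (drop k.+1 t); split=> //.
- by rewrite -deft perm_sym perm_sort.
- by rewrite size_take szt ks.
Qed.

Lemma count_mem_sub (T : eqType) (X s : seq T) :
  uniq s -> uniq X -> {subset X <= s} -> count [in X] s = size X.
Proof.
move=> us uX Xs; rewrite -size_filter; apply/perm_size/uniq_perm => //.
  by rewrite filter_uniq.
by move=> z; rewrite mem_filter /=; case zX: (z \in X); rewrite // Xs.
Qed.

Local Open Scope ring_scope.

Lemma opposite_signs (R : realDomainType) (T : eqType) (P : pred T) (f : T -> R)
    (s : seq T) :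
    (forall z, P z -> f z <= 0) -> (forall z, z \in s -> ~~ P z -> 0 <= f z) ->
  {in s &, forall z w, P z != P w -> f z * f w <= 0}.
Proof.
move=> fP fNP z w zs ws; case Pz: (P z); case Pw: (P w) => // _.
  by rewrite mulr_le0_ge0 ?fP ?fNP ?Pw.
by rewrite mulr_ge0_le0 ?fP ?fNP ?Pz.
Qed.

(** * Plane geometry *)

Section Plane.
Variable R : realType.
Implicit Types o x y z w u e : 'rV[R]_2.

Lemma eq_rV2 u w : u 0 0 = w 0 0 -> u 0 1 = w 0 1 -> u = w.
Proof.
move=> e0 e1; apply/rowP => i.
have [->|->//] : i = 0 \/ i = 1; last exact: e0.
by case: i => -[|[|//]] lti; [left|right]; apply/val_inj.
Qed.

Definition dot u w : R := u 0 0 * w 0 0 + u 0 1 * w 0 1.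
Definition cross u w : R := u 0 0 * w 0 1 - u 0 1 * w 0 0.
Definition obtuse o x y : bool := dot (x - o) (y - o) <= 0.

Lemma obtuse_sym o : symmetric (obtuse o).
Proof. by move=> x y; rewrite /obtuse /dot; congr (_ <= _); ring. Qed.

Lemma enorm2E u : enorm u = Num.sqrt (u 0 0 ^+ 2 + u 0 1 ^+ 2).
Proof.
rewrite /enorm !big_ord_recl big_ord0 addr0.
by congr (Num.sqrt (_ + _ ^+ 2)); congr (u _ _); apply/val_inj.
Qed.

(** The squared distance of [o] to the centre of B(xy) exceeds the squared
    radius by the inner product of [x - o] and [y - o]. *)
Lemma obtuse_diam_ball o x y : obtuse o x y -> diam_ball x y o.
Proof.
rewrite /obtuse /dot /diam_ball /= !enorm2E !mxE => oxy.
have half : 2^-1 = Num.sqrt (2^-1 ^+ 2) :> R.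
  by rewrite sqrtr_sqr ger0_norm ?invr_ge0.
rewrite [X in _ <= _ * X]half -sqrtrM ?addr_ge0 ?sqr_ge0 //.
rewrite ler_wsqrtr //.
lra.
Qed.

Lemma dot_gt0 x y : x != y -> 0 < dot (y - x) (y - x).
Proof.
move=> xy; rewrite lt0r /dot -!expr2 addr_ge0 ?sqr_ge0 // andbT.
apply: contra xy; rewrite paddr_eq0 ?sqr_ge0 // !sqrf_eq0 !mxE !subr_eq0.
by move=> /andP[/eqP e0 /eqP e1]; apply/eqP/eq_rV2.
Qed.

(** [cross e] and [dot e] are, up to the factor |e|, the coordinates with
    respect to the orthogonal frame directed by [e]; the hypotheses say
    that [z] and [w] are in opposite closed quadrants of the frame centred
    at [o]. *)
Lemma obtuse_opposite o e z w : 0 < dot e e ->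
    cross e (z - o) * cross e (w - o) <= 0 ->
    dot e (z - o) * dot e (w - o) <= 0 ->
  obtuse o z w.
Proof.
move=> e0 c0 d0; rewrite /obtuse -(pmulr_rle0 _ e0).
have -> : dot e e * dot (z - o) (w - o) =
   cross e (z - o) * cross e (w - o) + dot e (z - o) * dot e (w - o).
  by rewrite /dot /cross; ring.
by rewrite -oppr_ge0 opprD addr_ge0 ?oppr_ge0.
Qed.

Definition lex_le u w :=
  (u 0 0 < w 0 0) || (u 0 0 == w 0 0) && (u 0 1 <= w 0 1).

Lemma lex_le_trans : transitive lex_le.
Proof.
move=> w u z; rewrite /lex_le => /orP[uw|/andP[/eqP-> uw]].
  all: move=> /orP[wz|/andP[/eqP<- wz]].
- by rewrite (lt_trans uw).
- by rewrite uw.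
- by rewrite wz.
- by rewrite eqxx (le_trans uw wz) orbT.
Qed.

Lemma lex_le_total : total lex_le.
Proof.
move=> u w; rewrite /lex_le; case: ltgtP => //= _; exact: le_total.
Qed.

Definition angle_le x u w := 0 <= cross (u - x) (w - x).

Lemma angle_le_total x : total (angle_le x).
Proof.
move=> u w; rewrite /angle_le.
have -> : cross (w - x) (u - x) = - cross (u - x) (w - x).
  by rewrite /cross; ring.
by rewrite oppr_ge0 le_total.
Qed.

(** The sign of the cross product is not transitive in general; it is when
    all directions lie in the half-open half-plane of lexicographically
    positive vectors, which is what the choice of [x] ensures. *)
Lemma angle_le_trans x (s : seq 'rV[R]_2) :
  {in s, forall z, lex_le x z} -> x \notin s ->
  {in s & &, transitive (angle_le x)}.
Proof.
move=> xmin xs w u z ws us zs.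
have nz v : v \in s -> (0 < v 0 0 - x 0 0) ||
    ((v 0 0 - x 0 0 == 0) && (0 < v 0 1 - x 0 1)).
  move=> vs; have := xmin v vs; rewrite /lex_le subr_gt0 subr_eq0 subr_gt0.
  case/orP => [->//|/andP[/eqP e1 le]]; rewrite e1 eqxx ltxx /=.
  rewrite lt_neqAle le andbT.
  by apply: contra xs => /eqP e2; rewrite (eq_rV2 e1 e2).
have := nz _ us; have := nz _ ws; have := nz _ zs.
rewrite /angle_le /cross !mxE.
set a := u 0 0 - _; set b := u 0 1 - _; set c := w 0 0 - _; set d := w 0 1 - _.
set f := z 0 0 - _; set g := z 0 1 - _.
move=> Hz Hw Hu uw wz.
have [c0|] := orP Hw; last first.
  (* If [w] is straight above [x], nothing comes later in another direction. *)
  move=> /andP[/eqP c0 d0]; move: Hu Hz uw wz; rewrite c0 => Hu Hz uw wz.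
  have f0 : f = 0 by case/orP: Hz => [f0|/andP[/eqP//]]; nra.
  have g0 : 0 < g by case/orP: Hz => [|/andP[]//]; rewrite f0 ltxx.
  have a0 : 0 <= a by case/orP: Hu => [/ltW//|/andP[/eqP->]].
  by rewrite f0 mulr0 subr0 mulr_ge0 // ltW.
have a0 : 0 <= a by case/orP: Hu => [/ltW//|/andP[/eqP->]].
have f0 : 0 <= f by case/orP: Hz => [/ltW//|/andP[/eqP->]].
rewrite -(pmulr_rge0 _ c0).
have -> : c * (a * g - b * f) = a * (c * g - d * f) + f * (a * d - b * c).
  by ring.
by rewrite addr_ge0 // mulr_ge0.
Qed.

(** Take for [x] the lexicographically first point and for [y] the point of
    rank [k] in the angular order around [x]. *)
Lemma halving_line (s : seq 'rV[R]_2) k : uniq s -> (k.+1 < size s)%N ->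
  exists x y L U, [/\ perm_eq s [:: x, y & L ++ U], size L = k,
    {in L, forall z, cross (y - x) (z - x) <= 0} &
    {in U, forall z, 0 <= cross (y - x) (z - x)}].
Proof.
move=> us ks.
have s0 : (0 < size s)%N by exact: leq_ltn_trans ks.
have [L0 [x [s' [ps /size0nil L00 _ xmin]]]] :=
  median_split (in3W lex_le_trans) (in2W lex_le_total) s0.
move: us; rewrite {}L00 /= in ps; rewrite (perm_uniq ps) => /andP[xs' _].
have ks' : (k < size s')%N by move: ks; rewrite (perm_size ps).
have [L [y [U [ps' szL leL leU]]]] :=
  median_split (angle_le_trans xmin xs') (in2W (@angle_le_total x)) ks'.
exists x, y, L, U; split=> // [|z zL].
  rewrite (perm_trans ps) // perm_cons (perm_trans ps') //.
  by rewrite (perm_catCA L [:: y] U).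
have -> : cross (y - x) (z - x) = - cross (z - x) (y - x).
  by rewrite /cross; ring.
by rewrite oppr_le0; apply: leL.
Qed.

(** * The cycle *)

Lemma obtuse_cycle (s : seq 'rV[R]_2) : uniq s -> (3 <= size s)%N ->
  exists o c, perm_eq c s /\ cycle (obtuse o) c.
Proof.
move=> us s3.
have [m sm] : exists m, size s = (odd (size s) + m.*2.+2)%N.
  by exists (size s)./2.-1; lia.
have [|x [y [L [U [pxy szL lec gec]]]]] := @halving_line s m us.
  by rewrite sm; lia.
have uxy := us; rewrite (perm_uniq pxy) /= in uxy.
have [xnyLU ynLU uLU] := and3P uxy.
have [xy [xL yL]] : x != y /\ x \notin L /\ y \notin L.
  move: xnyLU ynLU; rewrite inE !mem_cat !negb_or.
  by move=> /andP[-> /andP[-> _]] /andP[-> _].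
pose e := y - x; have e0 : 0 < dot e e by exact: dot_gt0.
pose le z w := dot e z <= dot e w.
have [|||D [q [V [pq szD leD geV]]]] := @median_split _ le s m.+1.
- by move=> w u z _ _ _; apply: le_trans.
- by move=> z w _ _; apply: le_total.
- rewrite sm; lia.
(* The point of the line xy with the same projection as [q]. *)
pose o := x + ((dot e q - dot e x) / dot e e) *: e.
have crossE z : cross e (z - o) = cross e (z - x).
  by rewrite /o /cross !mxE; ring.
have dotE z : dot e (z - o) = dot e z - dot e q.
  suff -> : dot e (z - o) =
      dot e z - dot e x - (dot e q - dot e x) / dot e e * dot e e.
    by rewrite divfK ?gt_eqF //; ring.
  by rewrite /o /dot !mxE; ring.
pose a z := cross e (z - o); pose b z := dot e (z - o).
have obt z w : a z * a w <= 0 -> b z * b w <= 0 -> obtuse o z w.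
  exact: obtuse_opposite.
have ax : a x = 0 by rewrite /a crossE /cross !mxE; ring.
have ay : a y = 0 by rewrite /a crossE /cross !mxE; ring.
have bq : b q = 0 by rewrite /b dotE subrr.
have aL z : z \in L -> a z <= 0 by move=> zL; rewrite /a crossE lec.
have aNL z : z \in s -> z \notin L -> 0 <= a z.
  rewrite (perm_mem pxy) !inE mem_cat => /or4P[/eqP->|/eqP->|->//|zU _].
  - by rewrite ax.
  - by rewrite ay.
  - by rewrite /a crossE gec.
have bD z : z \in D -> b z <= 0.
  by move=> zD; rewrite /b dotE subr_le0; apply: leD.
have bND z : z \in s -> z \notin D -> 0 <= b z.
  rewrite (perm_mem pq) mem_cat inE => /or3P[->//|/eqP-> _|zV _].
    by rewrite bq.
  by rewrite /b dotE subr_ge0; apply: geV.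
have bopp := opposite_signs bD bND.
have uD : uniq (D ++ q :: V) by rewrite -(perm_uniq pq).
have uL : uniq L by move: uLU; rewrite cat_uniq => /and3P[].
have [uuD qD] : uniq D /\ q \notin D.
  by move: uD; rewrite cat_uniq /= negb_or => /and3P[-> /andP[-> _] _].
have cD : count [in D] s = m.+1.
  by rewrite count_mem_sub // => z zD; rewrite (perm_mem pq) mem_cat zD.
exists o; case odd_s: (odd (size s)) in sm.
- have odd_case p p' : p \in s -> p' \in s -> p \notin L -> p' \notin L ->
      p' != p -> a p = 0 -> a p' = 0 -> q != p ->
      exists c, perm_eq c s /\ cycle (obtuse o) c.
    move=> ps p's pL p'L p'p ap ap' qp.
    have qs : q \in s by rewrite (perm_mem pq) mem_cat mem_head orbT.
    pose t := rem q (rem p s).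
    have pt : perm_eq s [:: p, q & t].
      rewrite (perm_trans (perm_to_rem ps)) // perm_cons perm_to_rem //.
      by rewrite (rem_filter _ us) mem_filter /= qp.
    have ts : {subset t <= s} by move=> z /mem_rem /mem_rem.
    (* [L] has one point less than half of the points other than [p]. *)
    pose h := [in p' :: L].
    have hL z : h z -> a z <= 0.
      by rewrite /h /= inE => /orP[/eqP->|/aL//]; rewrite ap'.
    have hNL z : z \in s -> ~~ h z -> 0 <= a z.
      by move=> zs; rewrite /h /= inE negb_or => /andP[_]; apply: aNL.
    have hopp := opposite_signs hL hNL.
    have ch : count h s = m.+1.
      rewrite count_mem_sub //= ?szL ?p'L //.
      move=> z; rewrite inE => /orP[/eqP->//|zL].
      by rewrite (perm_mem pxy) !inE mem_cat zL !orbT.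
    have hp : h p = false.
      by rewrite /h /= inE (negbTE pL) orbF eq_sym; apply/negbTE.
    have := permP pt [in D]; have := permP pt h; have := perm_size pt.
    rewrite sm ch cD /= hp (negbTE qD) !add0n => szt ct dt.
    have [|||z w zt wt vzw hzw|w wt vw|w wt hw||c pc oc] :=
      @cycle_one_point_per_axis _ _ (obtuse_sym o) [in D] h p q t m.
    + by case: szt.
    + by rewrite dt.
    + by rewrite ct.
    + by apply: obt; [apply: hopp | apply: bopp]; rewrite ?ts.
    + by apply: obt; [rewrite ap mul0r | apply: bopp => //; apply: ts].
    + by apply: obt; [apply: hopp => //; apply: ts | rewrite bq mul0r].
    + by apply: obt; [rewrite ap mul0r | rewrite bq mulr0].
    + by exists c; split=> //; rewrite (perm_trans pc) // perm_sym.
  have xs : x \in s by rewrite (perm_mem pxy) mem_head.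
  have ys : y \in s by rewrite (perm_mem pxy) !inE eqxx orbT.
  have [qx|qx] := eqVneq q x; last by apply: (odd_case x y); rewrite // eq_sym.
  by apply: (odd_case y x) => //; rewrite qx.
- have ts : {subset y :: L ++ U <= s}.
    by move=> z zt; rewrite (perm_mem pxy) inE zt orbT.
  have ts' : {subset L ++ U <= s}.
    by move=> z zt; apply: ts; rewrite inE zt orbT.
  have aopp := opposite_signs aL aNL.
  have xs : x \in s by rewrite (perm_mem pxy) mem_head.
  have := permP pxy [in D]; have := perm_size pxy.
  rewrite sm cD => szt dt.
  have [||||w wt vw|w wt vw|c pc oc] :=
    @cycle_two_points_on_axis _ _ (obtuse_sym o) [in D] [in L] x y (L ++ U) m.
  + by case: szt.
  + by rewrite count_mem_sub // => z zL; rewrite mem_cat zL.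
  + by rewrite dt.
  + move=> z w zt wt vzw hzw.
    by apply: obt; [apply: aopp | apply: bopp]; rewrite ?ts'.
  + by apply: obt; [rewrite ax mul0r | apply: bopp => //; apply: ts].
  + apply: obt; first by rewrite ay mul0r.
    by apply: bopp => //; [apply/ts/mem_head | exact: ts'].
  + by exists c; split=> //; rewrite (perm_trans pc) // perm_sym.
Qed.

Lemma cycle_tverberg (S : {fset 'rV[R]_2}) o c :
    perm_eq c (enum_fset S) -> (3 <= size c)%N -> cycle (obtuse o) c ->
  exists G : geom_graph R 2, tverberg_cycle S G.
Proof.
move=> pc c3 oc.
have uc : uniq c by rewrite (perm_uniq pc) fset_uniq.
have cS : c =i S by exact: perm_mem pc.
pose adj x y := [&& x \in S, y \in S & (y == next c x) || (x == next c y)].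
have adjS x y : adj x y -> (x \in S) && (y \in S) by case/and3P=> -> ->.
have adjC : symmetric adj.
  by move=> x y; rewrite /adj andbCA orbC.
have adjI : irreflexive adj.
  move=> x; rewrite /adj; apply/negP => /and3P[xS _]; rewrite orbb.
  rewrite -cS in xS.
  have [i c' ec] := rot_to xS.
  rewrite -(next_rot i uc) ec /=.
  have : uniq (rot i c) by rewrite rot_uniq.
  have : (3 <= size (rot i c))%N by rewrite size_rot.
  rewrite ec; case: c' {ec} => // z c' _ /=.
  by rewrite eqxx inE negb_or => /andP[/andP[/negP]].
exists (GeomGraph adjS adjC adjI); split.
  split => //; exists c; split => // x y xS yS /=.
  by rewrite /adj xS yS.
exists o => -[x y] /and3P[/= xS yS].
case/orP => /eqP ->; apply: obtuse_diam_ball; last rewrite obtuse_sym.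
  by apply: next_cycle => //; rewrite cS.
by apply: next_cycle => //; rewrite cS.
Qed.
End Plane.

Theorem theorem1 (R : realType) (S : {fset 'rV[R]_2})
    (hS : (3 <= #|` S|)%N) :
  exists G : geom_graph R 2, tverberg_cycle S G.
Proof.
have [o [c [pc oc]]] := obtuse_cycle (fset_uniq S) hS.
by apply: (cycle_tverberg pc) oc; rewrite (perm_size pc).
Qed.
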